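(* Let $\gamma$ be a real number. There exists an infinite $f$-piercing sequence for some function $f$ with $f(n)=\gamma n+o(n)$ (as $n\to\infty$) if and only if $\gamma\geq\frac{1}{\ln 2}$.
   Context: Throughout, $f$ denotes a nondecreasing infinite sequence of positive integers $f(1),f(2),\ldots$ with $f(n)\geq n$ for all $n\ge 1$. A sequence $(x_1,x_2,\ldots,x_{f(N)})$ of real numbers in $[0,1)$ is called $f$-piercing of order $N$ if $\{x_1,x_2,\ldots,x_{f(n)}\}\cap\left[\frac{i}{n},\frac{i+1}{n}\right)\neq\emptyset$ holds for every $n=1,2,\ldots,N$ and every $i=0,1,\ldots,n-1$. An infinite sequence $X=(x_1,x_2,\ldots)$ of real numbers in $[0,1)$ is an infinite $f$-piercing sequence if for every $N\geq 1$ its prefix $(x_1,x_2,\ldots,x_{f(N)})$ is an $f$-piercing sequence of order $N$. *)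

(* Defs.v *)
From mathcomp Require Import all_boot all_order all_algebra.
From mathcomp Require Import all_classical all_reals all_analysis.
Set Implicit Arguments.
Unset Strict Implicit.
Unset Printing Implicit Defensive.
Import Order.TTheory GRing.Theory Num.Theory.
Import numFieldNormedType.Exports.
Local Open Scope classical_set_scope.
Local Open Scope ring_scope.

(* Infinite sequences are indexed from 1, so the values [f 0] and [x 0] are
   junk: nothing below constrains or uses them. *)

Definition admissible (f : nat -> nat) : Prop :=
  [/\ forall n, (1 <= n)%N -> (0 < f n)%N,
      forall m n, (1 <= m)%N -> (m <= n)%N -> (f m <= f n)%N &
      forall n, (1 <= n)%N -> (n <= f n)%N].

(* The tuple [s] lists (x_1, ..., x_{f N}), so [take (f n) s] lists
   x_1, ..., x_{f n}. *)
Definition piercing (R : realType) (f : nat -> nat) (N : nat)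
    (s : (f N).-tuple R) : Prop :=
  (forall y, y \in s -> 0 <= y < 1) /\
  forall n i : nat, (1 <= n <= N)%N -> (i < n)%N ->
    [set` take (f n) s] `&` `[i%:R / n%:R, (i.+1)%:R / n%:R[%classic !=set0.

Definition infinite_piercing (R : realType) (f : nat -> nat) (x : nat -> R)
    : Prop :=
  (forall k, (1 <= k)%N -> 0 <= x k < 1) /\
  forall N : nat, (1 <= N)%N ->
    @piercing R f N [tuple x k.+1 | k < f N].

(* Main.v *)
Require Import Defs.
From mathcomp Require Import all_boot all_order all_algebra.
From mathcomp Require Import all_classical all_reals all_analysis.
From mathcomp Require Import ring lra zify.
Import Order.TTheory GRing.Theory Num.Theory.
Import numFieldNormedType.Exports.
Local Open Scope classical_set_scope.
Local Open Scope ring_scope.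

(** The rate [1 / ln 2] is attained by the binary logarithms modulo 1 of the odd
    numbers 1, 3, 5, ..., and a counting argument of De Bruijn and Erdos shows that
    no sequence does better.

    Sufficiency.  Doubling an integer does not change its binary logarithm modulo
    1, so the first [m] odd numbers give the same points as all the integers of
    [(m, 2m]].  Consecutive ones are at distance at most
    [log2 (1 + 1/m) < 1 / (m ln 2)], which is at most [1/n] as soon as
    [m >= n / ln 2]; hence every cell of the [n]-th grid contains one of them
    ([log2_mod1_dense], [log2_odd_pierces]), and [f n] can be taken just above
    [gamma * n].

    Necessity.  Suppose that [f n <= g n] for large [n].  Consider the [M + 1] gaps
    left in the unit interval by the first [M] points.  If every gap still empty
    after [M + r] points had length at most about [g / (M + r)], then, since [r] new
    points meet at most [r] gaps, the [(r+1)]-st longest of the original gaps would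
    be at most [g / (M + r)], and summing over [r <= M] would give
    [1 <= g (1/M + ... + 1/(2M))], that is [1 <= g ln 2] in the limit
    ([sum_le_of_rank], [total_length_le], [piercing_rate_bound]).

    Piercing the [n]-th grid alone only forces gaps shorter than [2/n]
    ([gap_le_two]), because the cells need not be aligned with a gap.  But all the
    grids of a window [n, ..., n + w] are pierced, and unless the left end [a] of
    the gap is close to a fraction with denominator at most [Q], the multiples of
    [a] by the members of some window of length independent of [n] come within
    [1/Q] below an integer (Dirichlet's approximation, [numerator_just_above]).
    Then a cell starts just to the right of [a], and the gap is at most
    [(1 + 1/Q) / n] ([gap_le_far]).  The gaps that start near one of the finitely
    many fractions have negligible total length ([sum_gaps_near]). *)

(** * Diophantine approximation *)

(** Pigeonhole on the fractional parts of 0, a, 2a, ..., Q a. *)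
Lemma dirichlet_approximation (R : realType) (Q : nat) (a : R) :
  (0 < Q)%N -> 0 <= a < 1 ->
  exists p q : nat,
    [/\ (p <= Q)%N, (0 < q <= Q)%N & `|q%:R * a - p%:R| < Q%:R^-1].
Proof.
move=> Q0 /andP[a0 a1].
pose T (j : nat) := Num.truncn (j%:R * a).
pose u (j : nat) : R := j%:R * a - (T j)%:R.
have Q0R : 0 < Q%:R :> R by rewrite ltr0n.
have u01 j : 0 <= u j < 1.
  have /truncn_itv : 0 <= j%:R * a by rewrite mulr_ge0.
  by rewrite -/(T j) -natr1 /u => /andP[h1 h2]; apply/andP; split; lra.
have hlt (j : 'I_Q.+1) : (Num.truncn (Q%:R * u j) < Q)%N.
  have /andP[h1 h2] := u01 j.
  rewrite truncn_lt_nat ?mulr_ge0//.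
  by rewrite -[ltRHS]mulr1 ltr_pM2l.
pose h j := Ordinal (hlt j).
have /injectivePn[j [k jk hjk]] : ~~ injectiveb h.
  apply/negP => /injectiveP /leq_card; rewrite !card_ord; lia.
wlog ltjk : j k jk hjk / (j < k)%N.
  move=> W; case: (ltngtP j k) => [?|?|jk']; first exact: (W j k).
    by apply: (W k j) => //; rewrite eq_sym.
  by move: jk; rewrite (ord_inj jk') eqxx.
have Tjk : (T j <= T k)%N.
  by apply: le_truncn; rewrite ler_wpM2r// ler_nat ltnW.
exists (T k - T j)%N, (k - j)%N; split.
- rewrite (leq_trans (leq_subr _ _))//.
  rewrite -(ler_nat R) (le_trans (_ : _ <= k%:R * a))//.
    by rewrite truncn_le mulr_ge0.
  have kQ : (k <= Q)%N by rewrite -ltnS.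
  rewrite (le_trans (_ : _ <= k%:R)) ?ler_nat//.
  by rewrite -[leRHS]mulr1 ler_wpM2l// ltW.
- by rewrite subn_gt0 ltjk (leq_trans (leq_subr _ _))// -ltnS.
have e : u k - u j = (k - j)%:R * a - (T k - T j)%:R.
  by rewrite /u !natrB// ?(ltnW ltjk)//; ring.
rewrite -e.
have /(congr1 val)/= ejk := hjk.
have : 0 <= Q%:R * u k by have /andP[] := u01 k; nra.
move/truncn_itv; rewrite -ejk -natr1.
have : 0 <= Q%:R * u j by have /andP[] := u01 j; nra.
move/truncn_itv; rewrite -natr1.
move=> /andP[h1 h2] /andP[h3 h4].
rewrite -div1r ltr_pdivlMr// -[X in _ * X]gtr0_norm// -normrM ltr_norml.
by apply/andP; split; lra.
Qed.

(** Moving [n] in steps of a Dirichlet denominator [q] of [a] moves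
    [n a] modulo 1 by the small nonzero amount [q a - p], so it cannot jump
    over a window of length [Q^-1].  The number of steps needed to travel once
    around the circle is bounded because [q a - p] is at least [kappa]. *)
Lemma numerator_just_above (R : realType) (Q K : nat) (kappa a : R) :
  (0 < Q)%N -> 0 < kappa -> 1 <= K%:R * kappa -> 0 <= a < 1 ->
  (forall p q, (p <= Q)%N -> (0 < q <= Q)%N -> kappa <= `|q%:R * a - p%:R|) ->
  forall n0, exists n i : nat,
    [/\ (n0 <= n <= n0 + Q * K)%N, 0 < i%:R - n%:R * a &
        i%:R - n%:R * a <= Q%:R^-1].
Proof.
move=> Q0 k0 Kk a01 far n0.
have [p [q [pQ qQ small]]] := dirichlet_approximation R Q a Q0 a01.
have big := far _ _ pQ qQ.
have /andP[a0 a1] := a01.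
have /truncn_itv/andP[] : 0 <= n0%:R * a by rewrite mulr_ge0.
set i0 := Num.truncn _; rewrite -natr1 => i0l i0u.
have wind k : (k <= K)%N -> (n0 <= n0 + k * q <= n0 + Q * K)%N.
  by move=> kK; rewrite leq_addr leq_add2l mulnC leq_mul//; case/andP: qQ.
have [sgn|sgn] := leP 0 (q%:R * a - p%:R).
- (* each step lowers [i - n a]: stop just before it becomes nonpositive *)
  move: small big; rewrite ger0_norm//.
  set t := _ - p%:R => small big.
  pose v0 : R := i0%:R + 1 - n0%:R * a.
  have exP : exists k : nat, v0 <= k%:R * t.
    exists K; rewrite (le_trans (_ : _ <= K%:R * kappa))//.
      by rewrite /v0; lra.
    by rewrite ler_wpM2l.
  case: (ex_minnP exP) => -[|k] Pk kmin; first by move: Pk; rewrite /v0; lra.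
  have kK : (k.+1 <= K)%N.
    apply: kmin; rewrite (le_trans (_ : _ <= K%:R * kappa))//.
      by rewrite /v0; lra.
    by rewrite ler_wpM2l.
  have Pk' : k%:R * t < v0.
    by rewrite ltNge; apply/negP => /kmin; rewrite ltnn.
  exists (n0 + k * q)%N, (i0.+1 + k * p)%N.
  have -> : (i0.+1 + k * p)%:R - (n0 + k * q)%:R * a = v0 - k%:R * t :> R.
    by rewrite /v0 /t !natrD !natrM -natr1; ring.
  move: Pk; rewrite -natr1 => Pk; split; first exact/wind/ltnW.
    by lra.
  by lra.
- (* each step raises [i - n a]: stop as soon as it becomes positive *)
  move: small big; rewrite ltr0_norm// opprB.
  have := sgn; rewrite -oppr_gt0 opprB.
  set t := p%:R - _ => t0 small big.
  pose y : R := n0%:R * a - i0%:R.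
  have y0 : 0 <= y by rewrite /y; lra.
  have /truncn_itv/andP[] : 0 <= y / t by rewrite divr_ge0// ltW.
  set k := Num.truncn _; rewrite ler_pdivlMr// ltr_pdivrMr// => kl ku.
  have kK : (k.+1 <= K)%N.
    rewrite /k truncn_lt_nat ?divr_ge0// ?(ltW t0)// ltr_pdivrMr//.
    rewrite (lt_le_trans (_ : y < K%:R * kappa))//; first by rewrite /y; lra.
    by rewrite ler_wpM2l.
  exists (n0 + k.+1 * q)%N, (i0 + k.+1 * p)%N.
  have -> : (i0 + k.+1 * p)%:R - (n0 + k.+1 * q)%:R * a = k.+1%:R * t - y :> R.
    by rewrite /y /t !natrD !natrM; ring.
  split; first exact: wind.
    by lra.
  by move: ku; rewrite -natr1; lra.
Qed.

(** * Gaps left by a piercing sequence *)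

(** Points are indexed from 0 here, so that the first [f n] of them are the [y j]
    with [j < f n]. *)
Definition pierces (R : realType) (f : nat -> nat) (y : nat -> R) : Prop :=
  forall n i : nat, (i < n)%N ->
    exists2 j, (j < f n)%N & i%:R / n%:R <= y j < i.+1%:R / n%:R.

Lemma infinite_piercingP (R : realType) (f : nat -> nat) (x : nat -> R) :
  admissible f ->
  infinite_piercing f x <->
  (forall j, 0 <= x j.+1 < 1) /\ pierces R f (fun j => x j.+1).
Proof.
move=> [_ fmono _]; split=> [[x01 px]|[x01 px]]; split.
- by move=> j; apply: x01.
- move=> n i ltin; have n0 : (0 < n)%N by case: n ltin.
  have [_ /(_ n i)] := px n n0.
  rewrite n0 leqnn => /(_ isT ltin)[z []] /=.
  move=> zs; rewrite in_itv/= => zi.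
  have /mapP[j _ zj] := mem_take zs; move: zi; rewrite zj.
  by move=> xj; exists j => //; apply: ltn_ord.
- by case=> // k _; apply: x01.
- move=> N N0; split=> [z|n i /andP[n0 nN] ltin].
    by move=> /mapP[j _ ->].
  have [j jn xj] := px n i ltin.
  have jN : (j < f N)%N by apply: leq_trans jn _; apply: fmono.
  exists (x j.+1); split => /=; last by rewrite in_itv.
  have e : x j.+1 = nth 0 (take (f n) [tuple x k.+1 | k < f N]) j.
    rewrite nth_take//.
    by rewrite -[j]/(val (Ordinal jN)) -tnth_nth tnth_mktuple.
  rewrite e; apply: mem_nth; rewrite size_take size_tuple.
  by case: ifP.
Qed.

(** The cell [[i/n, (i+1)/n)] starts to the right of [a]; being pierced, it
    cannot end before [b]. *)
Lemma gap_le_of_cell (R : realType) (f : nat -> nat) (y : nat -> R)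
    (a b : R) (n i : nat) :
  pierces R f y -> (0 < n)%N -> b <= 1 -> n%:R * a < i%:R ->
  (forall j, (j < f n)%N -> ~~ (a < y j < b)) ->
  n%:R * (b - a) <= 1 + (i%:R - n%:R * a).
Proof.
move=> py n0 b1 ai free; rewrite leNgt; apply/negP => gap.
have n0R : 0 < n%:R :> R by rewrite ltr0n.
have ib : i.+1%:R < n%:R * b by rewrite -natr1; lra.
have ltin : (i < n)%N.
  rewrite -(ltr_nat R) (lt_le_trans (_ : _ < i.+1%:R)) ?ltr_nat//.
  by rewrite (le_trans (ltW ib))// -[leRHS]mulr1 ler_pM2l.
have [j jn] := py _ _ ltin.
rewrite ler_pdivrMr// ltr_pdivlMr// mulrC => /andP[h1 h2].
move/negP: (free _ jn); apply; apply/andP; split.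
  by rewrite -(ltr_pM2l n0R); lra.
by rewrite -(ltr_pM2l n0R); lra.
Qed.

Lemma gap_le_two (R : realType) (f : nat -> nat) (y : nat -> R)
    (a b : R) (n : nat) :
  pierces R f y -> (0 < n)%N -> 0 <= a -> b <= 1 ->
  (forall j, (j < f n)%N -> ~~ (a < y j < b)) ->
  n%:R * (b - a) <= 2.
Proof.
move=> py n0 a0 b1 free.
have /truncn_itv/andP[] : 0 <= n%:R * a by rewrite mulr_ge0.
set i := Num.truncn _ => il iu.
have := @gap_le_of_cell _ _ _ _ _ _ i.+1 py n0 b1 iu free.
by rewrite -natr1; lra.
Qed.

(** For [q = 0] the quotient is 0, which is a fraction to be avoided anyway. *)
Definition far_from_small_fractions (R : realType) (Q : nat) (kappa a : R) :=
  [forall p : 'I_Q.+1, forall q : 'I_Q.+1, kappa <= `|a - p%:R / q%:R|].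

(** Near a fraction with a small denominator the grids for nearby [n] have aligned
    cells, and a gap may have length close to [2/n]; elsewhere some grid in a
    window of bounded length has a cell starting just to the right of [a]. *)
Lemma gap_le_far (R : realType) (f : nat -> nat) (y : nat -> R)
    (Q K : nat) (kappa a b : R) (n : nat) :
  (forall m n, (0 < m)%N -> (m <= n)%N -> (f m <= f n)%N) ->
  pierces R f y ->
  (0 < Q)%N -> 0 < kappa -> 1 <= K%:R * kappa ->
  (0 < n)%N -> 0 <= a <= b -> b <= 1 ->
  far_from_small_fractions R Q kappa a ->
  (forall j, (j < f (n + Q * K))%N -> ~~ (a < y j < b)) ->
  n%:R * (b - a) <= 1 + Q%:R^-1.
Proof.
move=> fmono py Q0 k0 Kk n0 /andP[a0 ab] b1 far free.
have [a1|a1] := ltP a 1; last first.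
  have -> : b = a by lra.
  by rewrite subrr mulr0 addr_ge0// invr_ge0.
have far' p q : (p <= Q)%N -> (0 < q <= Q)%N -> kappa <= `|q%:R * a - p%:R|.
  move=> pQ /andP[q0 qQ]; have q0R : 0 < q%:R :> R by rewrite ltr0n.
  have /forallP/(_ (Ordinal (pQ : (p < Q.+1)%N)))/forallP := far.
  move=> /(_ (Ordinal (qQ : (q < Q.+1)%N)))/= h.
  have -> : q%:R * a - p%:R = q%:R * (a - p%:R / q%:R).
    by field; rewrite gt_eqF.
  rewrite normrM gtr0_norm//; apply: le_trans h _.
  by rewrite -[leLHS]mul1r ler_wpM2r// ler1n.
have a01 : 0 <= a < 1 by rewrite a0.
have [m [i [/andP[nm mw] i1 i2]]] :=
  numerator_just_above R Q K kappa a Q0 k0 Kk a01 far' n.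
have m0 : (0 < m)%N by apply: leq_trans nm.
have free' j : (j < f m)%N -> ~~ (a < y j < b).
  by move=> jm; apply: free; apply: leq_trans jm _; apply: fmono.
have ai : m%:R * a < i%:R by lra.
have := @gap_le_of_cell _ _ _ _ _ _ i py m0 b1 ai free'.
have : n%:R * (b - a) <= m%:R * (b - a).
  by rewrite ler_wpM2r ?ler_nat//; lra.
by lra.
Qed.

(** * Counting gaps *)

(** The entry of rank [r] is at most [c r]; the induction removes the largest entry,
    which shifts the ranks by one. *)
Lemma sum_le_of_rank_seq (R : realType) (s : seq R) (c : nat -> R) :
  sorted >=%R s ->
  (forall r, (r < size s)%N -> (count (fun z => (c r < z)%R) s <= r)%N) ->
  \sum_(z <- s) z <= \sum_(r < size s) c r.
Proof.
elim: s c => [|z s IH] c /= zs cnt; first by rewrite big_nil big_ord0.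
rewrite big_cons big_ord_recl/= lerD//.
  by have := cnt 0%N isT; rewrite leNgt; case: ltP => //.
apply: (IH (fun r => c r.+1)); first exact: path_sorted zs.
move=> r rs; have := cnt r.+1 rs; case: ltP => [_|zc _].
  by rewrite add1n ltnS.
suff -> : count (fun w => (c r.+1 < w)%R) s = 0%N by [].
apply/eqP; rewrite -leqn0 leqNgt -has_count; apply/hasPn => w ws.
rewrite -leNgt (le_trans _ zc)//.
have /allP := order_path_min (@ge_trans _ _) zs.
by apply.
Qed.

Lemma sum_le_of_rank (R : realType) (K : nat) (a c : nat -> R) :
  (forall r, (r < K)%N -> (#|[pred k : 'I_K | (c r < a k)%R]| <= r)%N) ->
  \sum_(k < K) a k <= \sum_(r < K) c r.
Proof.
move=> cnt.
pose s := sort >=%R [seq a k | k : 'I_K].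
have sz : size s = K by rewrite size_sort size_image card_ord.
have -> : \sum_(k < K) a k = \sum_(z <- s) z.
  have /permPl/(perm_big _) -> := perm_sort >=%R [seq a k | k : 'I_K].
  by rewrite big_map big_enum.
have := sum_le_of_rank_seq R s c; rewrite sz; apply.
  by apply: sort_sorted => u v; apply: le_total.
move=> r rK; apply: leq_trans (cnt r rK).
have /permPl/permP -> := perm_sort >=%R [seq a k | k : 'I_K].
rewrite count_map cardE /enum_mem size_filter count_filter.
by apply/eq_leq/eq_count => k; rewrite /= andbT.
Qed.

(** Only the intervals [[t k, t (k+1))] starting within [kappa] of [v] are
    counted; they are disjoint and lie in an interval of length [2 kappa + D].
    Clipping [t] to that interval turns this into a telescoping sum. *)
Lemma sum_gaps_near (R : realType) (t : nat -> R) (K : nat) (v kappa D : R) :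
  {homo t : m n / (m <= n)%N >-> m <= n} -> 0 <= kappa -> 0 <= D ->
  (forall k, (k < K)%N -> t k.+1 - t k <= D) ->
  \sum_(k < K | `|t k - v| < kappa) (t k.+1 - t k) <= 2 * kappa + D.
Proof.
move=> tmono k0 D0 gD.
pose phi z := Num.min (Num.max z (v - kappa)) (v + kappa + D).
have phi_mono z w : z <= w -> phi z <= phi w.
  by move=> zw; rewrite /phi; apply: le_min2 => //; apply: le_max2.
have phi_id z : v - kappa <= z <= v + kappa + D -> phi z = z.
  by move=> /andP[h1 h2]; rewrite /phi max_l// min_l.
rewrite (@le_trans _ _ (\sum_(k < K) (phi (t k.+1) - phi (t k))))//.
  rewrite big_mkcond/=; apply: ler_sum => k _.
  have tk : t k <= t k.+1 by apply: tmono.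
  case: ifPn => [|_]; last by rewrite subr_ge0 phi_mono.
  rewrite ltr_norml => /andP[h1 h2]; have := gD k (ltn_ord k) => h3.
  by rewrite !phi_id//; apply/andP; split; lra.
rewrite -(big_mkord predT (fun k => phi (t k.+1) - phi (t k))).
rewrite telescope_sumr//.
have : phi (t K) <= v + kappa + D by rewrite /phi ge_min lexx orbT.
have : v - kappa <= phi (t 0%N) by rewrite /phi le_min le_max lexx orbT/=; lra.
by lra.
Qed.

(** The De Bruijn--Erdos counting argument.  The gaps are disjoint, so the first
    [r] new points [z] meet at most [r] of them; hence at most [r] of the gaps in
    the good region exceed [c r], and their total length is at most the sum of the
    [c r].  The remaining gaps start near one of boundedly many fractions. *)
Lemma total_length_le (R : realType) (t z c : nat -> R) (K Q : nat)
    (kappa D : R) :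
  {homo t : m n / (m <= n)%N >-> m <= n} -> t 0%N = 0 -> t K = 1 ->
  0 <= kappa -> 0 <= D ->
  (forall k, (k < K)%N -> t k.+1 - t k <= D) ->
  (forall r, (r < K)%N -> 0 <= c r) ->
  (forall k r, (k < K)%N -> (r < K)%N ->
     far_from_small_fractions R Q kappa (t k) ->
     (forall j, (j < r)%N -> ~~ (t k < z j < t k.+1)) ->
     t k.+1 - t k <= c r) ->
  1 <= \sum_(r < K) c r + Q.+1%:R ^+ 2 * (2 * kappa + D).
Proof.
move=> tmono t0 tK k0 D0 gD c0 gfar.
pose gap k := t k.+1 - t k.
have gap0 k : 0 <= gap k by rewrite subr_ge0 tmono.
have total : \sum_(k < K) gap k = 1.
  by rewrite -(big_mkord predT gap) telescope_sumr// tK t0 subr0.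
pose far k := far_from_small_fractions R Q kappa (t k).
have -> : Q.+1%:R ^+ 2 * (2 * kappa + D)
    = \sum_(p < Q.+1) \sum_(q < Q.+1) (2 * kappa + D).
  by rewrite !sumr_const !card_ord -mulrnA -natrX mulr_natl.
rewrite -[leLHS]total (bigID (fun k : 'I_K => far k))/=; apply: lerD.
  pose a k := if far k then gap k else 0.
  rewrite big_mkcond/=; apply: (@sum_le_of_rank _ _ a) => r rK.
  pose hit (k : 'I_K) := [pick j : 'I_r | t k < z j < t k.+1].
  have hitP (k : 'I_K) : c r < a k ->
      exists2 j : 'I_r, hit k = Some j & t k < z j < t k.+1.
    rewrite /a; case: ifPn => [fk ck|_]; last by rewrite ltNge c0.
    rewrite /hit; case: pickP => [j hj|none]; first by exists j.
    suff : gap k <= c r by rewrite leNgt ck.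
    apply: gfar => // j jr.
    by have := none (Ordinal jr); rewrite /= => ->.
  have hit_inj : {in [pred k : 'I_K | (c r < a k)%R] &, injective hit}.
    move=> k l /hitP[j -> /andP[h1 h2]] /hitP[j' -> /andP[h3 h4]] [ejj].
    move: h3 h4; rewrite -ejj => h3 h4.
    case: (ltngtP k l) => [kl|kl|/ord_inj//].
      by exfalso; have := tmono _ _ kl; lra.
    by exfalso; have := tmono _ _ kl; lra.
  rewrite -(card_in_image hit_inj) -[leqRHS]card_ord.
  have Some_inj' : injective (@Some 'I_r) by move=> u v [].
  rewrite -[leqRHS](fintype.card_image Some_inj').
  apply/subset_leq_card/fintype.subsetP => o /fintype.imageP[k ck ->].
  have [j -> _] := hitP k ck.
  exact: fintype.image_f.
rewrite (@le_trans _ _ (\sum_(k < K) \sum_(p < Q.+1) \sum_(q < Q.+1)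
    if `|t k - p%:R / q%:R| < kappa then gap k else 0))//.
  rewrite big_mkcond/=; apply: ler_sum => k _.
  have pos (p q : 'I_Q.+1) :
      0 <= (if `|t k - p%:R / q%:R| < kappa then gap k else 0) by case: ifP.
  case: ifPn => [|_]; last by rewrite !sumr_ge0// => p _; rewrite sumr_ge0.
  rewrite negb_forall => /existsP[p]; rewrite negb_forall => /existsP[q].
  rewrite -ltNge => near.
  rewrite (bigD1 p)//= (bigD1 q)//= near -addrA lerDl addr_ge0//.
    by rewrite sumr_ge0.
  by rewrite sumr_ge0// => p' _; rewrite sumr_ge0.
rewrite exchange_big/=.
apply: ler_sum => p _; rewrite exchange_big/=; apply: ler_sum => q _.
by rewrite -big_mkcond/=; apply: sum_gaps_near.
Qed.

(** * The lower bound on the rate *)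

(** The default value 1 of [nth] closes the last gap, and the added point 0 opens the
    first one. *)
Lemma exists_sorted_points (R : realType) (y : nat -> R) (M : nat) :
  (forall j, 0 <= y j < 1) ->
  exists t : nat -> R,
    [/\ {homo t : m n / (m <= n)%N >-> m <= n}, t 0%N = 0, t M.+1 = 1 &
        forall j k, (j < M)%N -> ~~ (t k < y j < t k.+1)].
Proof.
move=> y01; pose s := sort <=%R (0 :: mkseq y M).
have sz : size s = M.+1 by rewrite size_sort/= size_mkseq.
have s01 z : z \in s -> 0 <= z <= 1.
  rewrite mem_sort inE => /predU1P[->|/mapP[j _ ->]]; first by rewrite lexx ler01.
  by have /andP[-> /ltW ->] := y01 j.
have t_le1 k : nth 1 s k <= 1.
  have [ks|sk] := ltnP k (size s); last by rewrite nth_default.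
  by have /andP[] := s01 _ (mem_nth 1 ks).
have tmono : {homo nth 1 s : m n / (m <= n)%N >-> m <= n}.
  move=> m n mn; have [ns|sn] := ltnP n (size s); last by rewrite (nth_default _ sn).
  apply: (sorted_leq_nth le_trans le_refl) => //; last first.
    by rewrite inE (leq_ltn_trans mn).
  exact: sort_le_sorted.
exists (nth 1 s); split => //.
- apply/eqP; rewrite eq_le; apply/andP; split.
    have : 0 \in s by rewrite mem_sort mem_head.
    by move=> /(nthP 1)[i _ si]; rewrite -[leRHS]si; apply: tmono.
  have : (0 < size s)%N by rewrite sz.
  by move=> /(mem_nth 1)/s01/andP[].
- by rewrite nth_default// sz.
- move=> j k jM; apply/negP => /andP[].
  have : y j \in s by rewrite mem_sort inE map_f ?orbT// mem_iota.
  move=> /(nthP 1)[l _ <-]; have [lk|kl] := leqP l k.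
    by move=> h; have := tmono _ _ lk; rewrite leNgt h.
  by move=> _ h; have := tmono _ _ kl; rewrite leNgt h.
Qed.

(** Comparison of [1/v] with the increment of the logarithm from [v - 1] to [v]. *)
Lemma sum_inv_le_ln (R : realType) (Y : R) (K : nat) :
  0 < Y -> \sum_(r < K) (Y + r.+1%:R)^-1 <= ln (Y + K%:R) - ln Y.
Proof.
move=> Y0; pose L k := ln (Y + k%:R).
have -> : ln (Y + K%:R) - ln Y = \sum_(r < K) (L r.+1 - L r).
  by rewrite -(big_mkord predT (fun r => L r.+1 - L r)) telescope_sumr// /L addr0.
apply: ler_sum => r _; rewrite /L.
set v := Y + r.+1%:R; have v0 : 1 < v.
  by rewrite /v -natr1; have := ler0n R r; lra.
have vr : Y + r%:R = v * (1 + - v^-1).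
  rewrite mulrDr mulrN mulr1 divff; last by rewrite gt_eqF//; lra.
  by rewrite /v -natr1; ring.
have v1 : v^-1 < 1 by rewrite invf_lt1//; lra.
rewrite vr lnM ?posrE; [|lra|lra].
have : ln (1 + - v^-1) <= - v^-1 by apply: le_ln1Dx; lra.
by lra.
Qed.

Lemma harmonic_block_le (R : realType) (Y C e : R) (K : nat) :
  0 < Y -> 0 < e -> C <= 2 * e * Y -> K%:R = Y + C ->
  \sum_(r < K) (Y + r.+1%:R)^-1 <= ln 2 + e.
Proof.
move=> Y0 e0 CY KY; rewrite (le_trans (sum_inv_le_ln _ _ K Y0))//.
rewrite -ln_div ?posrE//; last by have := ler0n R K; lra.
rewrite (@le_trans _ _ (ln (2 * (1 + e))))//.
  rewrite ler_ln ?posrE; last by lra.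
    by rewrite ler_pdivrMr// KY; nra.
  by rewrite divr_gt0//; have := ler0n R K; lra.
rewrite lnM ?posrE; [|lra|lra].
by rewrite lerD2l; apply: le_ln1Dx; lra.
Qed.

(** The first [M] points leave [M+1] gaps; the sum of the bounds available while
    the next [M] points arrive is about [g * (1/M + ... + 1/(2M))], that is
    [g * ln 2], and it has to cover the whole unit interval up to the gaps near
    small fractions. *)
Lemma piercing_rate_bound (R : realType) (f : nat -> nat) (y : nat -> R)
    (g e : R) (n1 : nat) :
  (forall m n, (0 < m)%N -> (m <= n)%N -> (f m <= f n)%N) ->
  pierces R f y -> (forall j, 0 <= y j < 1) ->
  0 < g -> 0 < e -> (forall n, (n1 <= n)%N -> (f n)%:R <= g * n%:R) ->
  1 <= (1 + e) * g * (ln 2 + e) + 2 * e.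
Proof.
move=> fmono py y01 g0 e0 fg.
pose Q := (Num.truncn e^-1).+1.
have Qe : Q%:R^-1 <= e.
  by rewrite -[leRHS]invrK lef_pV2 ?posrE ?invr_gt0//; apply/ltW/truncnS_gt.
have Q0 : (0 < Q)%N by [].
pose S : R := Q.+1%:R ^+ 2.
have S0 : 0 < S by rewrite exprn_gt0.
(* at most [S] fractions, each with an interval of length [2 kappa] around it *)
pose kappa : R := e / (2 * S).
have k0 : 0 < kappa by rewrite divr_gt0// mulr_gt0.
pose K := (Num.truncn kappa^-1).+1.
have Kk : 1 <= K%:R * kappa.
  by rewrite -ler_pdivrMr// div1r; apply/ltW/truncnS_gt.
pose w := (Q * K)%N; pose C : R := g * (w%:R + 1).
have C0 : 0 <= C by rewrite mulr_ge0 ?addr_ge0// ltW.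
(* the three terms make the grid index exceed [n1 + w], the harmonic sum close to
   [ln 2], and the gaps near small fractions negligible *)
pose B : R := g * (n1%:R + w%:R + 2) + (C + 2) / e + 2 * g * S / e.
pose M := (Num.truncn (B + C + 1)).+1; pose Y : R := M%:R - C - 1.
have YB : B < Y by have := truncnS_gt (B + C + 1); rewrite -/M /Y; lra.
have B1 : 0 <= g * (n1%:R + w%:R + 2) by rewrite mulr_ge0 ?addr_ge0// ltW.
have B2 : 0 < (C + 2) / e by rewrite divr_gt0//; lra.
have B3 : 0 < 2 * g * S / e by rewrite divr_gt0// !mulr_gt0.
have Y0 : 0 < Y by move: YB; rewrite /B; lra.
have [t [tmono t0 tM told]] := exists_sorted_points R y M y01.
have t01 k : (k <= M.+1)%N -> 0 <= t k <= 1.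
  move=> kM; have := tmono _ _ (leq0n k); have := tmono _ _ kM.
  by rewrite t0 tM => -> ->.
(* the largest grid that is certainly pierced by the first [m] points *)
have grid m : (M <= m)%N -> exists n,
    [/\ (n1 <= n)%N, (w < n)%N, (f n <= m)%N & m%:R - g < g * n%:R].
  move=> Mm; pose n := Num.truncn (m%:R / g); exists n.
  have /truncn_itv/andP[] : 0 <= m%:R / g by rewrite divr_ge0// ltW.
  rewrite -/n -natr1 ler_pdivlMr// ltr_pdivrMr// => n1' n2.
  have Mm' : M%:R <= m%:R :> R by rewrite ler_nat.
  have big : n1%:R + w%:R + 1 < n%:R :> R.
    rewrite -(ltr_pM2l g0); move: YB; rewrite /B /Y; lra.
  have n1n : (n1 <= n)%N.
    by rewrite -(ler_nat R); have := ler0n R w; lra.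
  split => //.
  - by rewrite -(ltr_nat R); have := ler0n R n1; lra.
  - by rewrite -(ler_nat R) (le_trans (fg _ n1n))// mulrC.
  - by lra.
have gap_any k : (k < M.+1)%N -> t k.+1 - t k <= 2 * g / Y.
  move=> kM; have [n [n1n wn fn gn]] := grid M (leqnn M).
  have /andP[tk0 _] := t01 k (ltnW kM); have /andP[_ tk1] := t01 k.+1 kM.
  have n0 : (0 < n)%N by apply: leq_ltn_trans wn.
  have := gap_le_two _ _ _ _ _ _ py n0 tk0 tk1.
  move=> /(_ (fun j jn => told j k (leq_trans jn fn))) h.
  rewrite ler_pdivlMr//.
  have tk : 0 <= t k.+1 - t k by rewrite subr_ge0 tmono.
  have gw : 0 <= g * w%:R by rewrite mulr_ge0// ltW.
  have : Y <= g * n%:R by rewrite /Y /C; lra.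
  nra.
pose c r : R := (1 + e) * g * (Y + r.+1%:R)^-1.
have Yr r : 0 < Y + r.+1%:R by rewrite addr_gt0.
have ge0 : 0 <= (1 + e) * g by rewrite mulr_ge0// ?ltW//; lra.
have gap_far k r : (k < M.+1)%N -> (r < M.+1)%N ->
    far_from_small_fractions R Q kappa (t k) ->
    (forall j, (j < r)%N -> ~~ (t k < y (M + j)%N < t k.+1)) ->
    t k.+1 - t k <= c r.
  move=> kM rM far new.
  have [n [n1n wn fn gn]] := grid (M + r)%N (leq_addr _ _).
  have /andP[tk0 _] := t01 k (ltnW kM); have /andP[_ tk1] := t01 k.+1 kM.
  have n0 : (0 < n - w)%N by rewrite subn_gt0.
  have tk : t k <= t k.+1 by apply: tmono.
  have tk' : 0 <= t k <= t k.+1 by rewrite tk0.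
  have free j : (j < f (n - w + Q * K))%N -> ~~ (t k < y j < t k.+1).
    rewrite subnK; last exact: ltnW.
    move=> /leq_trans/(_ fn); have [jM _|Mj] := ltnP j M; first exact: told.
    by rewrite -{1}(subnKC Mj) ltn_add2l => /new; rewrite subnKC.
  have := gap_le_far _ _ _ _ _ _ _ _ _
    fmono py Q0 k0 Kk n0 tk' tk1 far free.
  move=> h; rewrite /c ler_pdivlMr//.
  have : Y + r.+1%:R <= g * (n - w)%:R.
    rewrite natrB; last exact: ltnW.
    by move: gn; rewrite /Y /C natrD -[r.+1%:R]natr1; lra.
  have : (n - w)%:R * (t k.+1 - t k) <= 1 + e by lra.
  have : 0 <= t k.+1 - t k by lra.
  move: ((n - w)%:R : R) (t k.+1 - t k) (Y + r.+1%:R) => N G Z G0 h1 h2.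
  nra.
have := total_length_le R t (fun j => y (M + j)%N) c M.+1 Q kappa (2 * g / Y)
  tmono t0 tM (ltW k0) _ gap_any _ gap_far.
rewrite -/S => /(_ _ _)/le_trans; apply.
- by rewrite divr_ge0// ?mulr_ge0// ltW.
- by move=> r _; rewrite mulr_ge0// invr_ge0 ltW.
apply: lerD.
  rewrite -mulr_sumr ler_wpM2l//.
  apply: (harmonic_block_le _ _ (C + 2)) => //; last by rewrite -natr1 /Y; lra.
  have : (C + 2) / e <= Y by move: YB; rewrite /B; lra.
  by rewrite ler_pdivrMr//; nra.
rewrite mulrDr.
have -> : S * (2 * kappa) = e by rewrite /kappa; field; rewrite gt_eqF.
have : S * (2 * g / Y) <= e.
  have -> : S * (2 * g / Y) = 2 * g * S / Y by ring.
  rewrite ler_pdivrMr// [leRHS]mulrC -ler_pdivrMr//.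
  by move: YB; rewrite /B; lra.
by lra.
Qed.

Lemma ln2_bounds (R : realType) : 2^-1 <= ln (2 : R) <= 1.
Proof.
apply/andP; split.
  have : ln (1 + - 2^-1) <= - 2^-1 :> R by apply: le_ln1Dx; lra.
  have -> : 1 + - 2^-1 = 2^-1 :> R by field.
  by rewrite lnV ?posrE// lerN2.
by rewrite -[X in ln X]/(1 + 1); apply: le_ln1Dx; lra.
Qed.

Lemma ln2_gt0 (R : realType) : 0 < ln (2 : R).
Proof. by rewrite ln_gt0// ltr1n. Qed.

Lemma le_of_piercing_rate (R : realType) (f : nat -> nat) (gamma : R)
    (x : nat -> R) :
  admissible f ->
  (fun n : nat => (f n)%:R : R) =
    (fun n : nat => gamma * n%:R) +o_\oo (fun n : nat => n%:R : R) ->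
  infinite_piercing f x -> 1 / ln 2 <= gamma.
Proof.
move=> adm /eqaddoP fo px; have [fpos fmono fge] := adm.
have [x01 py] := (infinite_piercingP R f x adm).1 px.
have l0 := ln2_gt0 R; have /andP[l1 l2] := ln2_bounds R.
rewrite ler_pdivrMr// leNgt; apply/negP => small.
(* expanding [(1 + e) (gamma + e) (ln 2 + e) + 2 e] with [gamma < 2] and [e <= 1]
   gives less than [gamma ln 2 + 13 e] *)
pose e : R := (1 - gamma * ln 2) / 13.
have e0 : 0 < e by rewrite divr_gt0//; lra.
have [n1 _ fn1] := fo e e0.
have dev n : (n1 <= n)%N -> `|(f n)%:R - gamma * n%:R| <= e * n%:R.
  by move=> /fn1; rewrite /= [X in _ <= _ * X]ger0_norm.
have fg n : (n1 <= n)%N -> (f n)%:R <= (gamma + e) * n%:R.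
  by move=> /dev; rewrite ler_norml => /andP[_]; lra.
have g1 : 1 <= gamma + e.
  have : n1.+1%:R <= (gamma + e) * n1.+1%:R.
    by rewrite (le_trans _ (fg _ (leqnSn _)))// ler_nat fge.
  by rewrite -ler_pdivrMr// divff.
have := piercing_rate_bound R f _ (gamma + e) e n1
  fmono py x01 (lt_le_trans ltr01 g1) e0 fg.
have e13 : 13 * e = 1 - gamma * ln 2 by rewrite /e; field.
have g2 : gamma < 2 by nra.
have e1 : e <= 1 by nra.
move: (ln 2 : R) l0 l1 l2 e13 {small fg dev fn1 fo} => L L0 L1 L2 e13 bound.
have h1 : (1 + e) * (L + e) <= L + 3 * e by nra.
have h2 : (gamma + e) * ((1 + e) * (L + e)) <= (gamma + e) * (L + 3 * e).
  by rewrite ler_wpM2l//; lra.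
nra.
Qed.

(** * Binary logarithms of the odd numbers *)

Definition log2_mod1 (R : realType) (m : nat) : R :=
  let l := ln m%:R / ln 2 in l - (Num.truncn l)%:R.

Lemma log2_mod1_double (R : realType) (m v : nat) : (0 < m)%N ->
  log2_mod1 R (m * 2 ^ v) = log2_mod1 R m.
Proof.
move=> m0; have l0 := ln2_gt0 R.
rewrite /log2_mod1 natrM natrX lnM ?posrE ?ltr0n ?exprn_gt0// lnXn//.
have -> : (ln m%:R + ln 2 *+ v) / ln 2 = ln m%:R / ln 2 + v%:R :> R.
  by rewrite -mulr_natr; field; rewrite gt_eqF.
have h : 0 <= ln m%:R / ln 2 :> R by rewrite divr_ge0 ?(ltW l0)// ln_ge0// ler1n.
by rewrite [X in Num.truncn X]addrC truncnD ?natr_nat// natrK natrD; ring.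
Qed.

Lemma log2_mod1_itv (R : realType) (m : nat) : (0 < m)%N ->
  0 <= log2_mod1 R m < 1.
Proof.
move=> m0; have l0 := ln2_gt0 R.
have : 0 <= ln m%:R / ln 2 :> R by rewrite divr_ge0 ?(ltW l0)// ln_ge0// ler1n.
move=> /truncn_itv; rewrite /log2_mod1 -natr1 => /andP[h1 h2].
by apply/andP; split; lra.
Qed.

(** The integers of [(m, 2m]] and [m] itself have consecutive ratios at most
    [1 + 1/m], so their binary logarithms are spaced by less than
    [1 / (m ln 2) <= 1/n].  The witness is the least integer above a left end
    [2 ^ (s + i/n)], with [s] chosen to bring it into [(m, 2m]]. *)
Lemma log2_mod1_dense (R : realType) (m n i : nat) :
  (0 < m)%N -> (i < n)%N -> n%:R <= m%:R * ln 2 :> R ->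
  exists2 N, (0 < N <= m.*2)%N & i%:R / n%:R <= log2_mod1 R N < i.+1%:R / n%:R.
Proof.
move=> m0 ltin mn; have l0 := ln2_gt0 R.
have n0 : 0 < n%:R :> R by rewrite ltr0n; case: n ltin {mn}.
have mR : 0 < m%:R :> R by rewrite ltr0n.
pose a : R := i%:R / n%:R; pose A s : R := expR (ln 2 * (s%:R + a)).
have a0 : 0 <= a by rewrite divr_ge0.
have a1 : a + n%:R^-1 <= 1.
  by rewrite /a -[X in _ + X]mul1r -mulrDl natr1 ler_pdivrMr// mul1r ler_nat.
have ninv0 : 0 < n%:R^-1 :> R by rewrite invr_gt0.
have AS s : A s.+1 = 2 * A s.
  rewrite /A -natr1 (_ : ln 2 * _ = ln 2 + ln 2 * (s%:R + a)); last by ring.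
  by rewrite expRD lnK// posrE.
have exs : exists s, m%:R < A s.
  exists m; rewrite (@lt_le_trans _ _ (2 ^+ m))//.
    by rewrite -natrX ltr_nat ltn_expl.
  rewrite -[leLHS]lnK ?posrE ?exprn_gt0// ler_expR lnXn// -[_ *+ m]mulr_natr.
  by rewrite ler_wpM2l ?lerDl// ltW.
have [s ms A2] : exists2 s, m%:R < A s & A s <= 2 * m%:R.
  case: (ex_minnP exs) => -[|s] Ps smin.
    exists 0%N => //; rewrite (@le_trans _ _ 2)//; last by rewrite ler_peMr// ler1n.
    rewrite -[leRHS]lnK ?posrE// ler_expR add0r -[leRHS]mulr1.
    by rewrite ler_wpM2l ?(ltW l0)//; lra.
  exists s.+1 => //; rewrite AS ler_wpM2l//.
  by rewrite leNgt; apply/negP => /smin; rewrite ltnn.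
have A0 : 0 < A s by apply: expR_gt0.
have exN : exists N : nat, A s <= N%:R by exists (m.*2); rewrite -mul2n natrM.
case: (ex_minnP exN) => N AN Nmin.
have N0 : (0 < N)%N by rewrite -(ltr_nat R) (lt_le_trans A0).
have NA : N%:R < A s + 1.
  case: N N0 AN Nmin => // N _ _ /(_ N) h; rewrite -natr1 ltrD2r ltNge.
  by apply/negP => /h; rewrite ltnn.
have lnA : ln (A s) = ln 2 * (s%:R + a) by rewrite expRK.
have lo : ln 2 * (s%:R + a) <= ln N%:R.
  by rewrite -lnA ler_ln ?posrE ?ltr0n.
have hi : ln N%:R < ln 2 * (s%:R + a + n%:R^-1).
  have -> : ln 2 * (s%:R + a + n%:R^-1) = ln (A s) + ln 2 / n%:R.
    by rewrite lnA; ring.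
  have ratio : N%:R < A s * (1 + m%:R^-1).
    rewrite (lt_le_trans NA)// mulrDr mulr1 lerD2l.
    by rewrite ler_pdivlMr// mul1r ltW.
  have im : 0 < m%:R^-1 :> R by rewrite invr_gt0.
  have im1 : 0 < 1 + m%:R^-1 :> R by lra.
  have : ln N%:R < ln (A s * (1 + m%:R^-1)).
    by rewrite ltr_ln ?posrE ?ltr0n ?mulr_gt0.
  rewrite lnM ?posrE//.
  have : ln (1 + m%:R^-1) <= m%:R^-1 :> R by apply: le_ln1Dx; lra.
  have : m%:R^-1 <= ln 2 / n%:R :> R.
    by rewrite -div1r ler_pdivrMr// mulrAC ler_pdivlMr// mul1r mulrC.
  lra.
exists N; first by rewrite N0/=; apply: Nmin; rewrite -mul2n natrM.
have e : ln N%:R / ln 2 * ln 2 = ln N%:R :> R by rewrite divfK// gt_eqF.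
have lo' : s%:R + a <= ln N%:R / ln 2 by rewrite ler_pdivlMr// mulrC.
have hi' : ln N%:R / ln 2 < s%:R + a + n%:R^-1 by rewrite ltr_pdivrMr// mulrC.
have tr : Num.truncn (ln N%:R / ln 2 : R) = s.
  by apply: truncn_def; rewrite -natr1; apply/andP; split; lra.
rewrite /log2_mod1 tr -[i.+1%:R]natr1 mulrDl mul1r -/a.
by apply/andP; split; lra.
Qed.

(** The odd numbers below [2m] give the same points as the integers in [(m, 2m]],
    because doubling does not change the binary logarithm modulo 1. *)
Lemma log2_odd_pierces (R : realType) (f : nat -> nat) :
  (forall n, (0 < n)%N -> (n%:R : R) <= (f n)%:R * ln 2) ->
  pierces R f (fun j => log2_mod1 R j.*2.+1).
Proof.
move=> fn n i ltin; have l0 := ln2_gt0 R.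
have n0 : (0 < n)%N by case: n ltin.
have f0 : (0 < f n)%N.
  rewrite lt0n; apply/eqP => f0; have := fn n n0.
  by rewrite f0 mul0r lern0; case: n n0 {ltin f0}.
have [N /andP[N0 Nf] hN] := log2_mod1_dense R (f n) n i f0 ltin (fn n n0).
have [d] := pfactor_coprime (isT : prime 2) N0.
rewrite coprime2n => dodd Nd; have d0 : (0 < d)%N by case: d dodd {Nd}.
have dd : d = (d./2).*2.+1 by rewrite -[LHS]odd_double_half dodd.
exists d./2; last by rewrite -dd -(log2_mod1_double R d (logn 2 N))// -Nd.
have : (d <= N)%N by rewrite Nd leq_pmulr// expn_gt0.
lia.
Qed.

(** * The optimal rate *)

Lemma admissible_trunc (R : realType) (gamma : R) : 1 <= gamma ->
  admissible (fun n => (Num.truncn (gamma * n%:R)).+1).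
Proof.
move=> g1; have g0 : 0 <= gamma by lra.
split=> // [m n _ mn|n _].
  by rewrite ltnS; apply: le_truncn; rewrite ler_wpM2l// ler_nat.
apply: leqW; rewrite truncn_ge_nat; last by rewrite mulr_ge0.
by rewrite ler_peMl.
Qed.

Theorem theorem2 (R : realType) (gamma : R) :
  (exists f : nat -> nat,
     [/\ admissible f,
         (fun n : nat => (f n)%:R : R) =
           (fun n : nat => gamma * n%:R) +o_\oo (fun n : nat => n%:R : R) &
         exists x : nat -> R, infinite_piercing f x])
  <-> 1 / ln 2 <= gamma.
Proof.
split=> [[f [adm fo [x px]]]|]; first exact: le_of_piercing_rate adm fo px.
have l0 := ln2_gt0 R; have /andP[_ l1] := ln2_bounds R.
rewrite ler_pdivrMr// => gl.
have g1 : 1 <= gamma by nra.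
have adm := admissible_trunc R gamma g1.
exists (fun n => (Num.truncn (gamma * n%:R)).+1); split => //.
- apply/eqaddoP => e e0; near=> n.
  have /truncn_itv/andP[] : 0 <= gamma * n%:R by rewrite mulr_ge0//; lra.
  rewrite -natr1 => h1 h2.
  rewrite (_ : `|_| = `|(Num.truncn (gamma * n%:R)).+1%:R - gamma * n%:R|)//.
  rewrite -natr1 [X in _ <= _ * X]ger0_norm// (@le_trans _ _ 1)//.
    by rewrite ler_norml; apply/andP; split; lra.
  by rewrite mulrC -ler_pdivrMr//; near: n; apply: nbhs_infty_ger.
- exists (fun k => log2_mod1 R k.*2.-1); apply/infinite_piercingP => //.
  split=> [j|]; first exact: log2_mod1_itv.
  apply: log2_odd_pierces => n n0.
  have := truncnS_gt (gamma * n%:R).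
  have n0R : 0 < n%:R :> R by rewrite ltr0n.
  by move: (_.+1%:R : R) => z; nra.
Unshelve. all: by end_near. Qed.
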